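(* For every integer $N\ge1$ and all integers $m,n\ge0$ there is a bijection $$\phi_{2N}:\mathcal{D}_{2N}(m,n)\to \mathcal{D}_{2N-3}(m,n-2m)\cup\mathcal{D}_{2N-3}(m-1,n-2m+1)\cup\mathcal{D}_{2N-3}(m-2,n-2m+2).$$ In particular, $$D_{2N}(m,n)=D_{2N-3}(m,n-2m)+D_{2N-3}(m-1,n-2m+1)+D_{2N-3}(m-2,n-2m+2),$$ and $$d_{2N}(x)=(1+xq+x^2q^2)\,d_{2N-3}(xq^2).$$
   Context: A Schur partition is a partition of an integer into positive parts such that consecutive parts differ by at least $3$, and no two consecutive parts differing by exactly $3$ are both multiples of $3$. For a partition $\pi$, $m(\pi)$ is the number of parts of $\pi$ plus the number of even parts of $\pi$. For an integer $M$, $\mathcal{D}_M(m,n)$ is the set of Schur partitions $\pi$ of $n$ with $m(\pi)=m$ and all parts $\le M$ (for $M\le 0$ only the empty partition qualifies); sets with a negative index are empty. $D_M(m,n)=|\mathcal{D}_M(m,n)|$, and the Alladi–Schur polynomial is $d_M(x)=\sum_{m,n\ge0}D_M(m,n)x^mq^n$ (so $d_{-1}(x)=1$). *)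

(* Defs.v *)
From HB Require Import structures.
From mathcomp Require Import all_boot all_order all_algebra finmap.
From mathcomp Require Import boolp classical_sets functions cardinality fsbigop.

Set Implicit Arguments.
Unset Strict Implicit.
Unset Printing Implicit Defensive.
Import Order.TTheory GRing.Theory Num.Theory.

Local Open Scope classical_set_scope.
Local Open Scope ring_scope.

Definition is_partition (s : seq nat) : bool :=
  sorted geq s && all (fun i => 0 < i)%N s.

(* Parts are listed in nonincreasing order, so a is the larger of two consecutive
   parts; truncated subtraction is harmless since 3 <= a - b forces b < a. *)
Definition schur_gap (a b : nat) : bool :=
  (3 <= a - b)%N && ~~ [&& a - b == 3, 3 %| a & 3 %| b]%N.

Definition schur_partition (s : seq nat) : bool :=
  is_partition s && sorted schur_gap s.

Definition mstat (s : seq nat) : nat :=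
  (size s + count (fun i => ~~ odd i) s)%N.

(* All three indices are integers: for M <= 0 only [::] qualifies as a list of
   parts, and for m < 0 or n < 0 the set is empty. *)
Definition calD (M m n : int) : set (seq nat) :=
  [set s | [/\ schur_partition s, all (fun i : nat => i%:Z <= M) s,
               (mstat s)%:Z = m & (sumn s)%:Z = n]].

Definition D (M m n : int) : nat := #|` fset_set (calD M m n)|.

(* {poly {poly int}} is Z[q][x]: the outer indeterminate 'X is x. *)
Definition q : {poly {poly int}} := ('X)%:P.

Definition d (M : int) : {poly {poly int}} :=
  \sum_(p \in [set: nat * nat]) (D M p.1 p.2)%:R * ('X ^+ p.1 * q ^+ p.2).

(* [fset_set] and the finitely supported sum are total, with default values on
   infinite sets and supports; the facts below show that the defaults are never
   reached in [D] and [d]. *)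

Lemma finite_calD (M m n : int) : finite_set (calD M m n).
Proof.
pose k := `|n|%N.
apply: (@sub_finite_set _ _
  ((fun t : k.-bseq 'I_k.+1 => [seq val i | i <- t]) @` setT)); last first.
  exact/finite_image/finite_finset.
move=> s [/andP[/andP[_ s0] _] _ _ nE].
have kE : k = sumn s by rewrite /k -nE.
have ssz : (size s <= k)%N.
  rewrite kE; elim: s s0 {nE kE} => //= a s IH /andP[a0 /IH h].
  by rewrite -add1n leq_add.
have sk : all (fun i => i < k.+1)%N s.
  rewrite kE; elim: s {s0 nE kE ssz} => //= a s IH; rewrite ltnS leq_addr /=.
  apply: sub_all IH => i; rewrite !ltnS => /leq_trans; apply; exact: leq_addl.
have tsz : (size [seq inord i : 'I_k.+1 | i <- s] <= k)%N by rewrite size_map.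
exists (Bseq tsz) => //=; rewrite -map_comp -[RHS]map_id.
by apply/eq_in_map => i /(allP sk) /= ik; rewrite inordK.
Qed.

Lemma D_gt0P (M m n : int) : (0 < D M m n)%N <-> calD M m n !=set0.
Proof.
rewrite /D cardfs_gt0; split=> [/fset0Pn[s]|[s sD]].
  by rewrite (in_fset_set (@finite_calD _ _ _)) inE => sD; exists s.
by apply/fset0Pn; exists s; rewrite (in_fset_set (@finite_calD _ _ _)) inE.
Qed.

Lemma finite_supp_D (M : int) :
  finite_set [set p : nat * nat | D M p.1 p.2 != 0%N].
Proof.
pose k := `|M|%N; pose b := ((k + k) + k * k)%N.
apply: (@sub_finite_set _ _ (`I_b.+1 `*` `I_b.+1)); last first.
  by apply: finite_setX; exact: finite_II.
move=> [m n] /=; rewrite -lt0n => /D_gt0P[s [/andP[/andP[_ s0] sg] sM [mE] [nE]]].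
have sk : {in s, forall i, i <= k}%N.
  move=> i /(allP sM) iM; rewrite /k -lez_nat gez0_abs //.
  exact: le_trans iM.
have su : uniq s.
  apply: (@sorted_uniq _ gtn); [by move=> x y z /= yx xz; apply: ltn_trans yx|by move=> x /=; rewrite ltnn|].
  apply: sub_sorted sg => x y /andP[xy _] /=.
  by rewrite -subn_gt0; apply: leq_trans xy.
have szk : (size s <= k)%N.
  rewrite -(size_iota 1 k); apply: uniq_leq_size => // i si.
  by rewrite mem_iota add1n ltnS (allP s0 _ si) sk.
have nk : (sumn s <= size s * k)%N.
  elim: s sk {s0 sg sM mE nE su szk} => //= a s IH sk.
  rewrite mulSn leq_add ?sk ?mem_head// IH// => i si.
  by rewrite sk// inE si orbT.
split=> /=; rewrite ltnS /b.
  rewrite -mE (leq_trans _ (leq_addr _ _))// leq_add//.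
  exact: leq_trans (count_size _ _) szk.
by rewrite -nE (leq_trans nk)// (leq_trans _ (leq_addl _ _))// leq_mul2r szk orbT.
Qed.

Lemma coef_d (M : int) (m n : nat) : ((d M)`_m)`_n = (D M m n)%:R.
Proof.
pose A := fset_set [set p : nat * nat | D M p.1 p.2 != 0%N].
have AE : forall p, (p \in A) = (D M p.1 p.2 != 0%N).
  by move=> p; rewrite (in_fset_set (@finite_supp_D M)); apply/idP/idP; rewrite inE.
rewrite /d (fsbigE A) ?fset_uniq//; last first.
  by move=> p _; rewrite AE negbK => /eqP ->; rewrite mul0r.
rewrite (eq_bigl xpredT) => [|p]; last by rewrite in_setT.
rewrite coef_sum.
have cE (p : nat * nat) :
    (((D M p.1 p.2)%:R * ('X ^+ p.1 * q ^+ p.2))`_m)`_n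
      = (D M p.1 p.2)%:R * (p == (m, n))%:R :> int.
  rewrite [in LHS]mulr_natl !coefMn -[in LHS]mulr_natl; congr GRing.mul.
  rewrite /q -rmorphXn /= coefMC coefXn.
  case: p => a b /=; rewrite xpair_eqE /= [m == a]eq_sym.
  by case: (a == m); rewrite ?mul0r ?coef0 ?mul1r ?coefXn // eq_sym.
rewrite coef_sum.
under eq_bigr do rewrite cE.
have [mnA|] := boolP ((m, n) \in A); last first.
  rewrite AE negbK /= => /eqP D0; rewrite D0 big1 // => p _.
  by case: eqP => [->|_]; rewrite ?mulr0//= D0 mul0r.
rewrite (bigD1_seq (m, n)) ?fset_uniq//= eqxx mulr1 big1 ?addr0// => p /negbTE ->.
by rewrite mulr0.
Qed.

(* Main.v *)
(* Removing the largest part shows that d_M = d_(M-1) + x^e q^M d_(M-g), where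
   e = 1 or 2 according to the parity of M, and g = 4 or 3 according to whether
   3 divides M.  These coefficients have period 6 in M up to powers of q, and
   eliminating the indices of the wrong parity shows that d_(2N)(x) and
   d_(2N-3)(xq^2), as sequences in N, satisfy one and the same linear recurrence;
   hence they stay proportional with the ratio 1 + xq + x^2q^2 of the initial
   values.  The three target sets are disjoint, since their members have distinct
   values of m, so comparing coefficients gives the cardinalities and with them
   the bijection. *)
Require Import Defs.
From mathcomp Require Import all_boot all_order all_algebra.
From mathcomp Require Import boolp classical_sets functions.
From mathcomp Require Import finmap cardinality ring zify.

Import Order.TTheory GRing.Theory Num.Theory.
Local Open Scope classical_set_scope.
Local Open Scope ring_scope.

(** * Schur partitions and their largest part *)

Lemma calD_bounds {M m n : int} {s : seq nat} : calD M m n s -> 0 <= m /\ 0 <= n.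
Proof. by case=> _ _ <- <-. Qed.

(** What a part [k] contributes to [mstat]. *)
Definition weight (k : nat) : nat := if odd k then 1 else 2.

(** The least distance from a part [k] to the next smaller part: if 3 divides [k], a distance of
    exactly 3 would give two multiples of 3. *)
Definition gap (k : nat) : nat := if (3 %| k)%N then 4 else 3.

Lemma schur_gapE (a b : nat) : (0 < b)%N -> schur_gap a b = (b + gap a <= a)%N.
Proof.
rewrite /schur_gap /gap => b0; apply/idP/idP.
  by case: ifP => [a3|_] /andP[ab]; lia.
by case: ifP => [a3|/negbT a3] ab; apply/andP; split; lia.
Qed.

Lemma geq_trans : transitive geq.
Proof. by move=> x y z /= yx zy; apply: leq_trans zy yx. Qed.

(** As [t] is nonincreasing, the gap condition on its head bounds all of it. The bound is an
    integer, since [k - gap k] may be negative; then [t] must be empty. *)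
Lemma schur_cons (k : nat) (t : seq nat) : (0 < k)%N ->
  schur_partition (k :: t)
  = schur_partition t && all (fun i : nat => i%:Z <= k%:Z - (gap k)%:Z) t.
Proof.
move=> k0; rewrite /schur_partition /is_partition /= k0 /=.
case: t => [|b t] //=.
have [b0|] := boolP (0 < b)%N; last by rewrite !andbF.
rewrite schur_gapE // (path_sortedE geq_trans b).
apply/idP/idP.
  move=> /andP[/andP[/and3P[kb bt st] t0] /andP[bk gt]].
  rewrite bt st t0 gt /=; apply/andP; split; first by lia.
  by apply: sub_all bt => i /=; lia.
move=> /andP[/andP[/andP[/andP[bt st] t0] gt] /andP[bk _]].
by rewrite bt st t0 gt /= !andbT; apply/andP; split; lia.
Qed.

Lemma calD_rec (k : nat) (m n : int) : (0 < k)%N ->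
  calD k m n = calD (k%:Z - 1) m n
    `|` cons k @` calD (k%:Z - (gap k)%:Z) (m - (weight k)%:Z) (n - k%:Z).
Proof.
move=> k0; have mstat_cons t : mstat (k :: t) = (weight k + mstat t)%N.
  by rewrite /mstat /weight /=; case: odd => /=; lia.
apply/seteqP; split=> [s|s [[sP sk sm sn]|[t [tP tk tm tn] <-]]].
- case=> sP sk sm sn; case: s sP sk sm sn => [|a t] sP sk sm sn; first by left.
  have [ak|ak] := ltnP a k.
    left; split=> //; move: sP => /andP[/andP[/order_path_min -/(_ geq_trans) at_ _] _] /=.
    by apply/andP; split; [lia|apply: sub_all at_ => i /=; lia].
  have {ak} aE : a = k by move: sk => /= /andP[]; lia.
  subst a; right; exists t => //.
  move: sP; rewrite schur_cons // => /andP[tP tk]; split=> //.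
    by move: sm; rewrite mstat_cons; lia.
  by move: sn => /=; lia.
- by split=> //; apply: sub_all sk => i; lia.
- split=> //; first by rewrite schur_cons // tP.
  + by rewrite /= lexx /=; apply: sub_all tk => i; lia.
  + by rewrite mstat_cons; lia.
  + by move=> /=; lia.
Qed.

Lemma card_fset_setU {T : choiceType} {A B : set T} : finite_set A -> finite_set B ->
  A `&` B = set0 -> #|` fset_set (A `|` B)| = (#|` fset_set A| + #|` fset_set B|)%N.
Proof.
move=> fA fB AB0; rewrite fset_setU // -cardfsUI -fset_setI // AB0 fset_set0.
by rewrite cardfs0 addn0.
Qed.

Lemma D_rec (k : nat) (m n : int) : (0 < k)%N ->
  D k m n = (D (k%:Z - 1) m n
    + D (k%:Z - (gap k)%:Z) (m - (weight k)%:Z) (n - k%:Z))%N.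
Proof.
move=> k0; rewrite /D calD_rec // card_fset_setU; first congr addn.
- rewrite fset_set_image; last exact: finite_calD.
  by rewrite card_imfset //= => s t [].
- exact: finite_calD.
- exact/finite_image/finite_calD.
- rewrite -subset0 => s [[_ sk _ _] [t _ tE]]; move: sk; rewrite -tE /=.
  by move=> /andP[]; lia.
Qed.

(** * Recurrences for the polynomials and their dilations *)

Lemma D_neg {M m n : int} : (m < 0) || (n < 0) -> D M m n = 0%N.
Proof.
move=> mn0; apply/eqP; rewrite -leqn0 leqNgt; apply/negP => /D_gt0P[s /calD_bounds].
lia.
Qed.

Lemma d_npos {M : int} : M <= 0 -> d M = 1.
Proof.
move=> M0; apply/polyP => m; apply/polyP => n; rewrite coef_d coef1.
have calDE : calD M m n = if (m == 0%N) && (n == 0%N) then [set [::]] else set0.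
  apply/seteqP; split => [[|a s] [sP sM sm sn]|s].
  - have [-> ->] : m = 0%N /\ n = 0%N by move: sm sn; rewrite /mstat /=; lia.
    by [].
  - by move: sP sM => /andP[/andP[_ /= /andP[a0 _]] _] /andP[aM _]; lia.
  - by case: andP => [[/eqP -> /eqP ->] -> //|].
rewrite /D calDE; case: (m == 0%N); last by rewrite fset_set0 cardfs0 coef0.
by case: n {calDE} => [|n] /=; rewrite ?fset_set1 ?cardfs1 ?fset_set0 ?cardfs0 coef1.
Qed.

Lemma coef_monomM (a b : nat) (P : {poly {poly int}}) (m n : nat) :
  (('X ^+ a * q ^+ b * P)`_m)`_n
  = if (m < a)%N || (n < b)%N then 0 else (P`_(m - a))`_(n - b).
Proof.
rewrite -mulrA coefXnM /q -rmorphXn /=; case: ltnP => //= _; first by rewrite coef0.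
by rewrite coefCM coefXnM.
Qed.

Lemma coef_monomM_d (a b : nat) (M : int) (m n : nat) :
  (('X ^+ a * q ^+ b * d M)`_m)`_n = (D M (m%:Z - a%:Z) (n%:Z - b%:Z))%:R.
Proof.
(* Where the monomial leaves no coefficient, an index of [D] is negative and the count vanishes. *)
rewrite coef_monomM; case: ifPn => [mn|]; first by rewrite D_neg //; lia.
rewrite negb_or -!leqNgt => /andP[am bn].
by rewrite coef_d !subzn.
Qed.

Lemma d_rec (k : nat) : (0 < k)%N ->
  d k = d (k%:Z - 1) + 'X ^+ weight k * q ^+ k * d (k%:Z - (gap k)%:Z).
Proof.
move=> k0; apply/polyP => m; apply/polyP => n.
by rewrite !coefD coef_monomM_d !coef_d D_rec // natrD.
Qed.

Definition dil (P : {poly {poly int}}) : {poly {poly int}} := P \Po ('X * q ^+ 2).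

Lemma coef_dil (P : {poly {poly int}}) (m n : nat) :
  ((dil P)`_m)`_n = if (n < 2 * m)%N then 0 else (P`_m)`_(n - 2 * m).
Proof.
have -> : (dil P)`_m = P`_m * 'X^(2 * m).
  (* The factor [(m == i)%:R] reduces the sum to its term at [m], which is zero beyond the size of
     [P]. *)
  rewrite /dil coef_comp_poly (eq_bigr (fun i : 'I__ => P`_i * (m == i)%:R * 'X^(2 * m))).
    have [mP|mP] := ltnP m (size P).
      rewrite (bigD1 (Ordinal mP)) //= eqxx mulr1 big1 ?addr0 // => i.
      by rewrite -val_eqE /= eq_sym => /negbTE ->; rewrite mulr0 mul0r.
    rewrite big1 => [|i _]; first by rewrite nth_default ?mul0r.
    by rewrite (gtn_eqF (leq_trans (ltn_ord i) mP)) mulr0 mul0r.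
  move=> i _; rewrite /q exprMn -!rmorphXn /= coefMC coefXn -mulrA -exprM.
  by case: eqVneq => [->|]; rewrite ?mul0r.
by rewrite coefMXn.
Qed.

Lemma coef_dil_d (M : int) (m n : nat) :
  ((dil (d M))`_m)`_n = (D M m (n%:Z - 2 * m%:Z))%:R.
Proof.
rewrite coef_dil; case: ltnP => mn; first by rewrite D_neg //; lia.
by rewrite coef_d; congr ((D _ _ _)%:R); lia.
Qed.

(** [dil] is a ring morphism that fixes [q] and sends [x] to [x * q ^+ 2]. *)
Lemma dil_d_rec (k : nat) : (0 < k)%N ->
  dil (d k) = dil (d (k%:Z - 1))
    + ('X * q ^+ 2) ^+ weight k * q ^+ k * dil (d (k%:Z - (gap k)%:Z)).
Proof.
move=> k0; rewrite /dil [in LHS]d_rec // rmorphD !rmorphM !rmorphXn /=.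
by rewrite comp_polyX /q comp_polyC.
Qed.

(* The recurrence depends on the index modulo 6 only; [Q] stands for [q ^+ (6 * j)]
   when [U r] is [d (6 * j + r)], and [x] becomes [x * q ^+ 2] after dilation. *)
Definition schur_rec {A : comPzRingType} (x q Q : A) (U : int -> A) : Prop :=
  forall r : nat, (0 < r)%N ->
    U r = U (r%:Z - 1) + x ^+ weight r * (Q * q ^+ r) * U (r%:Z - (gap r)%:Z).

(* Eliminating the odd indices of [U] (resp. the even indices of [V]) leaves the
   same three-step recurrence, so three consecutive instances give the next three. *)
Lemma schur_rec_even_odd {A : comPzRingType} {x q Q l : A} {U V : int -> A} :
  l = 1 + x * q + x ^+ 2 * q ^+ 2 ->
  schur_rec x q Q U -> schur_rec (x * q ^+ 2) q Q V ->
  U 2 = l * V (- 1) -> U 4 = l * V 1 -> U 6 = l * V 3 ->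
  [/\ U 8 = l * V 5, U 10 = l * V 7 & U 12 = l * V 9].
Proof.
move=> lE recU recV U2 U4 U6.
have U5 : U 5 = U 4 + x * (Q * q ^+ 5) * U 2 := recU 5 isT.
have U7 : U 7 = U 6 + x * (Q * q ^+ 7) * U 4 := recU 7 isT.
have U8 : U 8 = U 7 + x ^+ 2 * (Q * q ^+ 8) * U 5 := recU 8 isT.
have U9 : U 9 = U 8 + x * (Q * q ^+ 9) * U 5 := recU 9 isT.
have U10 : U 10 = U 9 + x ^+ 2 * (Q * q ^+ 10) * U 7 := recU 10 isT.
have U11 : U 11 = U 10 + x * (Q * q ^+ 11) * U 8 := recU 11 isT.
have U12 : U 12 = U 11 + x ^+ 2 * (Q * q ^+ 12) * U 8 := recU 12 isT.
have V2 : V 2 = V 1 + (x * q ^+ 2) ^+ 2 * (Q * q ^+ 2) * V (- 1) := recV 2 isT.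
have V3 : V 3 = V 2 + (x * q ^+ 2) * (Q * q ^+ 3) * V (- 1) := recV 3 isT.
have V4 : V 4 = V 3 + (x * q ^+ 2) ^+ 2 * (Q * q ^+ 4) * V 1 := recV 4 isT.
have V5 : V 5 = V 4 + (x * q ^+ 2) * (Q * q ^+ 5) * V 2 := recV 5 isT.
have V6 : V 6 = V 5 + (x * q ^+ 2) ^+ 2 * (Q * q ^+ 6) * V 2 := recV 6 isT.
have V7 : V 7 = V 6 + (x * q ^+ 2) * (Q * q ^+ 7) * V 4 := recV 7 isT.
have V8 : V 8 = V 7 + (x * q ^+ 2) ^+ 2 * (Q * q ^+ 8) * V 5 := recV 8 isT.
have V9 : V 9 = V 8 + (x * q ^+ 2) * (Q * q ^+ 9) * V 5 := recV 9 isT.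
have {}U8 : U 8 = l * V 5 by rewrite U8 U7 U6 U5 U4 U2 V5 V4 V3 V2 lE; ring.
have {}U10 : U 10 = l * V 7.
  (* In terms of [V (- 1)], [V 1], [V 3] the coefficients do not match one by one; expanding [V 3]
     makes the sides agree. *)
  by rewrite U10 U9 U8 U7 U6 U5 U4 U2 V7 V6 V5 V4 V3 V2 lE; ring.
(* The passages from [U 10] to [U 12] and from [V 7] to [V 9] add the same multiple,
   [Q * (x * q ^+ 11 + x ^+ 2 * q ^+ 12)], of [U 8] and of [V 5]. *)
by split=> //; rewrite U12 U11 U10 U8 V9 V8; ring.
Qed.

(** 6 is a common period of [weight] (period 2) and [gap] (period 3). *)
Lemma schur_rec_shift6 {A : comPzRingType} {x q : A} {U : int -> A} (j : nat) :
  schur_rec x q 1 U -> schur_rec x q (q ^+ (6 * j)) (fun r => U ((6 * j)%:Z + r)).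
Proof.
move=> recU r r0; rewrite -PoszD recU; last by rewrite addn_gt0 r0 orbT.
have -> : weight (6 * j + r) = weight r by rewrite /weight oddD oddM.
have -> : gap (6 * j + r) = gap r by rewrite /gap dvdn_addr // dvdn_mulr.
by rewrite mul1r exprD PoszD !addrA.
Qed.

Lemma schur_rec_even {A : comPzRingType} {x q : A} {U V : int -> A} :
  schur_rec x q 1 U -> schur_rec (x * q ^+ 2) q 1 V ->
  (forall M, M <= 0 -> U M = 1) -> (forall M, M <= 0 -> V M = 1) ->
  forall N : int, 1 <= N ->
  U (2 * N) = (1 + x * q + x ^+ 2 * q ^+ 2) * V (2 * N - 3).
Proof.
move=> recU recV U0 V0; set l := 1 + _ + _.
pose S (M : int) := U M = l * V (M - 3).
have S6 (j : nat) : [/\ S ((6 * j)%:Z + 2), S ((6 * j)%:Z + 4) & S ((6 * j)%:Z + 6)].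
  elim: j => [|j [S2 S4 S6]].
    (* The constant values at nonpositive indices start both sequences; in particular [U 2] is [l]
       itself and [V (- 1)] is 1. *)
    have [u0 u1 u2] : [/\ U 0 = 1, U (- 1) = 1 & U (- 2) = 1] by split; apply: U0.
    have [v0 v1 v2] : [/\ V 0 = 1, V (- 1) = 1 & V (- 2) = 1] by split; apply: V0.
    have U1 : U 1 = U 0 + x * (1 * q ^+ 1) * U (- 2) := recU 1 isT.
    have U2 : U 2 = U 1 + x ^+ 2 * (1 * q ^+ 2) * U (- 1) := recU 2 isT.
    have U3 : U 3 = U 2 + x * (1 * q ^+ 3) * U (- 1) := recU 3 isT.
    have U4 : U 4 = U 3 + x ^+ 2 * (1 * q ^+ 4) * U 1 := recU 4 isT.
    have U5 : U 5 = U 4 + x * (1 * q ^+ 5) * U 2 := recU 5 isT.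
    have U6 : U 6 = U 5 + x ^+ 2 * (1 * q ^+ 6) * U 2 := recU 6 isT.
    have V1 : V 1 = V 0 + (x * q ^+ 2) * (1 * q ^+ 1) * V (- 2) := recV 1 isT.
    have V2 : V 2 = V 1 + (x * q ^+ 2) ^+ 2 * (1 * q ^+ 2) * V (- 1) := recV 2 isT.
    have V3 : V 3 = V 2 + (x * q ^+ 2) * (1 * q ^+ 3) * V (- 1) := recV 3 isT.
    have e1 : 2 - 3 = - 1 :> int by [].
    have e2 : 4 - 3 = 1 :> int by [].
    have e3 : 6 - 3 = 3 :> int by [].
    rewrite /S muln0 !add0r e1 e2 e3 U6 U5 U4 U3 U2 U1 V3 V2 V1.
    rewrite u0 u1 u2 v0 v1 v2 /l.
    by split; ring.
  have T2 : U ((6 * j)%:Z + 2) = l * V ((6 * j)%:Z - 1) by rewrite S2; congr (_ * V _); lia.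
  have T4 : U ((6 * j)%:Z + 4) = l * V ((6 * j)%:Z + 1) by rewrite S4; congr (_ * V _); lia.
  have T6 : U ((6 * j)%:Z + 6) = l * V ((6 * j)%:Z + 3) by rewrite S6; congr (_ * V _); lia.
  have [S8 S10 S12] := schur_rec_even_odd (erefl l) (schur_rec_shift6 j recU)
    (schur_rec_shift6 j recV) T2 T4 T6.
  have shift a : (6 * j.+1)%:Z + a = (6 * j)%:Z + (6 + a) by lia.
  by rewrite /S !shift; split; [rewrite S8|rewrite S10|rewrite S12];
    congr (_ * V _); lia.
move=> N N1.
(* Dividing [N - 1] by 3 puts [2 * N] in the block [6 * k + 2], [6 * k + 4], [6 * k + 6]. *)
have [k [i [i3 ->]]] : exists k i : nat, (i < 3)%N /\ N = (3 * k + i + 1)%N.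
  by exists (`|N - 1| %/ 3)%N, (`|N - 1| %% 3)%N; split; lia.
have [S2 S4 S6k] := S6 k; rewrite -[U _ = _]/(S _).
case: i i3 => [|[|[|//]]] _.
- by have -> : 2 * (3 * k + 0 + 1)%N%:Z = (6 * k)%:Z + 2 by lia.
- by have -> : 2 * (3 * k + 1 + 1)%N%:Z = (6 * k)%:Z + 4 by lia.
- by have -> : 2 * (3 * k + 2 + 1)%N%:Z = (6 * k)%:Z + 6 by lia.
Qed.

Theorem theorem6 (N : int) (hN : 1 <= N) :
  (forall m n : int, 0 <= m -> 0 <= n ->
     (exists phi : seq nat -> seq nat,
        set_bij (calD (2 * N) m n)
          (calD (2 * N - 3) m (n - 2 * m)
           `|` calD (2 * N - 3) (m - 1) (n - 2 * m + 1)
           `|` calD (2 * N - 3) (m - 2) (n - 2 * m + 2)) phi)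
     /\ D (2 * N) m n
        = (D (2 * N - 3) m (n - 2 * m)
           + D (2 * N - 3) (m - 1) (n - 2 * m + 1)
           + D (2 * N - 3) (m - 2) (n - 2 * m + 2))%N)
  /\ d (2 * N)
     = (1 + 'X * q + 'X ^+ 2 * q ^+ 2) * (d (2 * N - 3) \Po ('X * q ^+ 2)).
Proof.
have dE : d (2 * N) = (1 + 'X * q + 'X ^+ 2 * q ^+ 2) * dil (d (2 * N - 3)).
  apply: (@schur_rec_even _ _ _ d (dil \o d)) => // [r r0|r r0|M M0|M M0] /=.
  - by rewrite mul1r d_rec.
  - by rewrite mul1r dil_d_rec.
  - exact: d_npos.
  - by rewrite d_npos // /dil rmorph1.
split=> // m n m0 n0; set M := 2 * N - 3.
have DE : D (2 * N) m n = (D M m (n - 2 * m) + D M (m - 1) (n - 2 * m + 1)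
                           + D M (m - 2) (n - 2 * m + 2))%N.
  case: m m0 => // m _; case: n n0 => // n _.
  apply/eqP; rewrite -(eqr_nat int) !natrD -coef_d dE -/M; apply/eqP.
  (* The dilated factor has degree [m - a] in [x], which costs [2 * (m - a)] in the exponent of [q];
     so [n - a] becomes [n - 2 * m + a]. *)
  have coef_shift (a : nat) : (('X ^+ a * q ^+ a * dil (d M))`_m)`_n
      = (D M (m%:Z - a%:Z) (n%:Z - 2 * m%:Z + a%:Z))%:R :> int.
    rewrite coef_monomM; case: ifPn => [mn|]; first by rewrite D_neg //; lia.
    rewrite negb_or -!leqNgt => /andP[am an].
    by rewrite coef_dil_d; congr ((D _ _ _)%:R); lia.
  rewrite 2!mulrDl mul1r 2!coefD 2!coefD coef_dil_d.
  by rewrite (coef_shift 1%N) (coef_shift 2%N).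
split=> //.
have disj (a b c e : int) : a != b -> calD M a c `&` calD M b e = set0.
  move=> ab; rewrite -subset0 => s [[_ _ sa _] [_ _ sb _]].
  by move: ab; rewrite -sa -sb eqxx.
suff /card_bijP[f f_bij] : (calD (2 * N) m n #= calD M m (n - 2 * m)
    `|` calD M (m - 1) (n - 2 * m + 1) `|` calD M (m - 2) (n - 2 * m + 2))%card.
  (* [f] lives on the sets as subtypes; its extension to all lists takes the default value [[::]]
     outside the domain. *)
  by exists (valLR [::] f); apply/valLR_bijP.
apply/fcard_eq; rewrite ?finite_setU; do ?[split]; try exact: finite_calD.
rewrite !card_fset_setU ?finite_setU; do ?[split]; try exact: finite_calD.
- exact: DE.
- by apply: disj; lia.
- by rewrite setIUl !disj ?setU0 //; lia.
Qed.
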